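(* Let $\mathbb{P}^{n|m}$ be the $n|m$-dimensional complex projective superspace. Then $$\mathrm{Ber}(\Omega^1_{\mathbb{P}^{n|m}})\cong\mathcal{O}_{\mathbb{P}^{n|m}}(m-n-1).$$
   Context: The complex projective superspace $\mathbb{P}^{n|m}$ is the quotient of $(\mathbb{C}^{n+1|m})^\times$ (the restriction of $\mathbb{C}^{n+1|m}$ to $\mathbb{C}^{n+1}\setminus\{0\}$) by the $\mathbb{C}^*$-action scaling all even and odd coordinates by $\lambda$. It is a split supermanifold with a projection $\pi:\mathbb{P}^{n|m}\to\mathbb{P}^n$, and $\mathcal{O}_{\mathbb{P}^{n|m}}(\ell)=\pi^*\mathcal{O}_{\mathbb{P}^n}(\ell)$. $\Omega^1_{\mathbb{P}^{n|m}}$ is the cotangent sheaf, dual of the tangent sheaf, locally free of rank $n|m$ with local basis $dz_1,\ldots,dz_n,d\theta_1,\ldots,d\theta_m$. $\mathrm{Ber}$ denotes the Berezinian sheaf of a locally-free sheaf, whose transition functions are the Berezinians (superdeterminants) of the transition matrices of the sheaf. *)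

(* Defs.v *)
From HB Require Import structures.
From mathcomp Require Import all_boot all_order all_algebra.

Set Implicit Arguments.
Unset Strict Implicit.
Unset Printing Implicit Defensive.

Import Order.TTheory GRing.Theory Num.Theory.

Local Open Scope ring_scope.

(* The exterior algebra on generators xi_0, ..., xi_(m-1): the coefficient    *)
(* of a at A is that of the monomial xi_A, the product of the xi_i for i in A *)
(* taken in increasing order. The record prevents the canonical pointwise     *)
(* product of {ffun _ -> K} from being inferred.                              *)
Record grassmann (K : numFieldType) (m : nat) : Type :=
  Grassmann { gcoef :> {ffun {set 'I_m} -> K} }.

HB.instance Definition _ (K : numFieldType) m :=
  [isNew for @gcoef K m].
HB.instance Definition _ (K : numFieldType) m :=
  [Choice of grassmann K m by <:].

Section Grassmann.
Variables (K : numFieldType) (m : nat).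
Implicit Types (a b c : grassmann K m) (A B C E : {set 'I_m}).

Definition ginversions B C : nat :=
  (\sum_(i in B) \sum_(j in C) (j < i))%N.

Definition gzero : grassmann K m := Grassmann 0.
Definition gopp a : grassmann K m := Grassmann (- gcoef a).
Definition gadd a b : grassmann K m := Grassmann (gcoef a + gcoef b).

Definition gconst (k : K) : grassmann K m :=
  Grassmann [ffun A : {set 'I_m} => if A == set0 then k else 0].

Definition ggen (i : 'I_m) : grassmann K m :=
  Grassmann [ffun A : {set 'I_m} => (A == [set i])%:R].

(* xi_B * xi_C = (-1) ^ (ginversions B C) xi_(B :|: C) if B, C are disjoint,  *)
(* and 0 otherwise.                                                           *)
Definition gmul a b : grassmann K m :=
  Grassmann [ffun A : {set 'I_m} => \sum_(B : {set 'I_m} | B \subset A)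
     (-1) ^+ ginversions B (A :\: B) * (a B * b (A :\: B))].

Lemma gaddA : associative gadd.
Proof. by move=> a b c; apply: val_inj; rewrite /= addrA. Qed.
Lemma gaddC : commutative gadd.
Proof. by move=> a b; apply: val_inj; rewrite /= addrC. Qed.
Lemma gadd0 : left_id gzero gadd.
Proof. by move=> a; apply: val_inj; rewrite /= add0r. Qed.
Lemma gaddN : left_inverse gzero gopp gadd.
Proof. by move=> a; apply: val_inj; rewrite /= addNr. Qed.

HB.instance Definition _ :=
  GRing.isZmodule.Build (grassmann K m) gaddA gaddC gadd0 gaddN.

Lemma ginversions_setUl B C E : [disjoint B & C] ->
  ginversions (B :|: C) E = (ginversions B E + ginversions C E)%N.
Proof.
by move=> dBC; rewrite /ginversions -bigU //; apply: eq_bigl => i; rewrite !inE.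
Qed.

Lemma ginversions_setUr B C E : [disjoint C & E] ->
  ginversions B (C :|: E) = (ginversions B C + ginversions B E)%N.
Proof.
move=> dCE; rewrite /ginversions -big_split /=.
apply: eq_bigr => i _; rewrite -bigU //.
by apply: eq_bigl => j; rewrite !inE.
Qed.

Lemma gmulA : associative gmul.
Proof.
move=> a b c; apply: val_inj; apply/ffunP => A; rewrite /= !ffunE.
pose t B C := (-1) ^+ (ginversions B (C :\: B) + ginversions B (A :\: C)
              + ginversions (C :\: B) (A :\: C)) *
       (a B * b (C :\: B) * c (A :\: C)).
transitivity (\sum_(B : {set 'I_m} | B \subset A)
   \sum_(C : {set 'I_m} | (C \subset A) && (B \subset C)) t B C).
  apply: eq_bigr => B sBA; rewrite /gmul /= ffunE mulr_sumr mulr_sumr.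
  rewrite (reindex_onto (fun C : {set 'I_m} => C :\: B)
             (fun E : {set 'I_m} => E :|: B)) /=; last first.
    move=> E /subsetP sE; apply/setP => x; rewrite !inE.
    by have := sE x; rewrite inE; case: (x \in B); case: (x \in E) => //= /(_ isT).
  apply: eq_big => [C|C /andP[sC /eqP eC]].
    have -> : (C :\: B :|: B == C) = (B \subset C).
      apply/eqP/idP => [<-|/subsetP sBC]; first exact: subsetUr.
      apply/setP => x; rewrite !inE; have := sBC x.
      by case: (x \in B); case: (x \in C) => //= /(_ isT).
    have [sBC|_] := boolP (B \subset C); rewrite ?andbF // !andbT.
    apply/idP/idP => [|sCA]; last exact: setSD.
    move=> /subsetP sC; apply/subsetP => x xC; have := sC x.
    case xB: (x \in B); first by rewrite (subsetP sBA).
    by rewrite !inE xB xC => /(_ isT).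
  have sBC : B \subset C by rewrite -eC subsetUr.
  have e1 : A :\: B :\: (C :\: B) = A :\: C.
    apply/setP => x; rewrite !inE; have := subsetP sBC x.
    by case: (x \in B); case: (x \in C) => //= /(_ isT).
  have e2 : A :\: B = (C :\: B) :|: (A :\: C).
    apply/setP => x; rewrite !inE.
    have := subsetP sBC x; have := subsetP sC x; rewrite !inE.
    case: (x \in B); case: (x \in C); case: (x \in A) => //= h1 h2.
    - by have := h2 isT.
    - by have := h1 isT.
  have d2 : [disjoint C :\: B & A :\: C].
    rewrite -setI_eq0; apply/eqP/setP => x; rewrite !inE.
    by case: (x \in C); rewrite ?andbF.
  rewrite e1 /t {1}e2 ginversions_setUr // !exprD.
  by rewrite -!mulrA; congr (_ * (_ * _)); rewrite mulrCA !mulrA.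
rewrite (exchange_big_dep (fun C : {set 'I_m} => C \subset A)) /=; last first.
  by move=> B C _ /andP[].
apply: eq_bigr => C sCA; rewrite /gmul /= ffunE mulr_suml mulr_sumr.
apply: eq_big => [B|B sBC].
  rewrite sCA /=; have [sBC|_] := boolP (B \subset C); rewrite ?andbF //.
  by rewrite (subset_trans sBC).
have sB : B \subset C by case/andP: sBC => _ /andP[].
have e3 : C = B :|: (C :\: B).
  apply/setP => x; rewrite !inE; have := subsetP sB x.
  by case: (x \in B); case: (x \in C) => //= /(_ isT).
have d3 : [disjoint B & C :\: B].
  by rewrite -setI_eq0 setIDA setIC -setIDA setDv setI0.
have -> : ginversions C (A :\: C)
    = (ginversions B (A :\: C) + ginversions (C :\: B) (A :\: C))%N.
  by rewrite {1}e3 ginversions_setUl.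
by rewrite /t -addnA addnC exprD -!mulrA; congr (_ * _); rewrite !mulrA.
Qed.

Lemma gmul1 : left_id (gconst 1) gmul.
Proof.
move=> a; apply: val_inj; apply/ffunP => A; rewrite /= ffunE.
rewrite (bigD1 set0) ?sub0set //= big1 => [|B /andP[_ /negPf B0]].
  by rewrite addr0 ffunE eqxx setD0 mul1r /ginversions big_set0 mul1r.
by rewrite ffunE B0 mul0r mulr0.
Qed.

Lemma gmulr1 : right_id (gconst 1) gmul.
Proof.
move=> a; apply: val_inj; apply/ffunP => A; rewrite /= ffunE.
rewrite (bigD1 A) //= big1 => [|B /andP[sBA BA]].
  rewrite addr0 ffunE setDv eqxx mulr1 /ginversions big1 ?mul1r // => i _.
  by rewrite big_set0.
rewrite ffunE setD_eq0; case: ifPn => [sAB|_]; last by rewrite !mulr0.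
by move: BA; rewrite eqEsubset sBA sAB.
Qed.

Lemma gmulDl : left_distributive gmul gadd.
Proof.
move=> a b c; apply: val_inj; apply/ffunP => A; rewrite /= !ffunE -big_split.
by apply: eq_bigr => B _; rewrite /= ffunE mulrDl mulrDr.
Qed.

Lemma gmulDr : right_distributive gmul gadd.
Proof.
move=> a b c; apply: val_inj; apply/ffunP => A; rewrite /= !ffunE -big_split.
by apply: eq_bigr => B _; rewrite /= ffunE !mulrDr.
Qed.

Lemma gconst1_neq0 : gconst 1 != 0.
Proof.
apply/eqP => /(congr1 (fun a : grassmann K m => a set0)).
by rewrite /= !ffunE eqxx; apply/eqP; rewrite oner_eq0.
Qed.

HB.instance Definition _ := GRing.Zmodule_isNzRing.Build (grassmann K m)
  gmulA gmul1 gmulr1 gmulDl gmulDr gconst1_neq0.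

End Grassmann.

From mathcomp Require Import complex.
From mathcomp Require Import boolp classical_sets functions reals.
From mathcomp Require Import topology normedtype derive.

Import numFieldNormedType.Exports.

Local Open Scope classical_set_scope.

(* The Berezinian of a (p|q) x (p|q) matrix in block form [[A, B], [C, D]],   *)
(*   Ber = det (A - B D^-1 C) * (det D)^-1,                                   *)
(* meant for even invertible matrices over a supercommutative ring, where the *)
(* entries of both determinants commute. Inverses are two-sided, 0 if none.   *)
Definition ring_inv (A : pzRingType) (u : A) : A :=
  xget 0 [set v | u * v = 1 /\ v * u = 1].

Definition berezinian (A : pzRingType) (p q : nat) (M : 'M[A]_(p + q)) : A :=
  \det (ulsubmx M - ursubmx M *m ring_inv (drsubmx M) *m dlsubmx M)
  * ring_inv (\det (drsubmx M)).

(* Holomorphic: K-smooth, i.e. K-differentiable with partial derivatives of   *)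
(* all orders again K-differentiable. For K = R[i] these are the smooth       *)
(* functions with C-linear differential (smoothness being automatic there).   *)
Fixpoint Kdiff (K : numFieldType) (N k : nat) (U : set 'rV[K]_N)
    (f : 'rV[K]_N -> K) : Prop :=
  (forall x, U x -> differentiable f x) /\
  if k is k'.+1 then forall i : 'I_N, Kdiff k' U ('D_(delta_mx 0 i) f)
  else True.

Definition holomorphic (K : numFieldType) (N : nat) (U : set 'rV[K]_N)
    (f : 'rV[K]_N -> K) : Prop := forall k, Kdiff k U f.

(* The projective superspace of dimension n|m over K (to be used at           *)
(* K = R[i]) as the quotient of the punctured affine superspace of dimension  *)
(* n+1|m by the scaling action of K^*:                                        *)
(* - an open set of P^n is represented by its preimage, a scaling-invariant   *)
(*   open set of nonzero vectors;                                             *)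
(* - a section of the structure sheaf over U is a superfunction on U, i.e. a  *)
(*   sum of f_A(x) xi_A with holomorphic f_A, invariant under scaling of both *)
(*   the x_i and the xi_a.                                                    *)
(* Superfunctions on U are represented by total functions, regarded up to     *)
(* equality on U; restriction to smaller open sets is then the identity on    *)
(* representatives.                                                           *)
Section ProjectiveSuperspace.
Variables (K : numFieldType) (n m : nat).

Local Notation point := 'rV[K]_n.+1.
Local Notation sfun := (point -> grassmann K m).
Implicit Types (U V W : set point) (f g : sfun) (i j : 'I_n.+1).

Definition proj_open U : Prop :=
  [/\ open U, forall x, U x -> x != 0 &
      forall (l : K) x, l != 0 -> U x -> U (l *: x)].

Definition chart i : set point := [set x | x 0 i != 0].

Definition eq_on U f g : Prop := forall x, U x -> f x = g x.

Definition scale_xi (l : K) (a : grassmann K m) : grassmann K m :=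
  Grassmann [ffun A : {set 'I_m} => l ^+ #|A| * a A].

Definition struct_sheaf U f : Prop :=
  (forall A : {set 'I_m}, holomorphic U (fun x => f x A)) /\
  (forall (l : K) x, l != 0 -> U x -> scale_xi l (f (l *: x)) = f x).

Definition has_parity (p : bool) U f : Prop :=
  forall x (A : {set 'I_m}), U x -> odd #|A| != p -> f x A = 0.

(* The affine coordinates z_k = x_(lift i k) / x_i (the first n indices) and  *)
(* theta_b = xi_b / x_i (the last m indices) on chart i.                      *)
Definition coord i (a : 'I_(n + m)) : sfun := fun x =>
  match fintype.split a with
  | inl k => gconst m (x 0 (lift i k) / x 0 i)
  | inr b => gconst m (x 0 i)^-1 * ggen K b
  end.

(* The data of a sheaf of right modules over the structure sheaf, presented   *)
(* by representatives: sh_sec U is the set of sections over U, sh_eq U their  *)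
(* equality over U, sh_par p U the sections of parity p. Restriction maps are *)
(* the identity on representatives, as for superfunctions.                    *)
Record osheaf : Type := Osheaf {
  sh_car :> zmodType;
  sh_sec : set point -> sh_car -> Prop;
  sh_eq : set point -> sh_car -> sh_car -> Prop;
  sh_scale : sh_car -> sfun -> sh_car;
  sh_par : bool -> set point -> sh_car -> Prop }.

(* An isomorphism of sheaves of super modules; phi U acts on sections over U. *)
Record is_iso (E F : osheaf) (phi : set point -> E -> F) : Prop := {
  iso_sec : forall U s, proj_open U -> sh_sec U s -> sh_sec U (phi U s);
  iso_res : forall U V (s t : E), proj_open U -> proj_open V -> V `<=` U ->
    sh_sec U s -> sh_sec V t -> sh_eq V s t ->
    sh_eq V (phi U s) (phi V t);
  iso_add : forall U s t, proj_open U -> sh_sec U s -> sh_sec U t ->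
    sh_eq U (phi U (s + t)) (phi U s + phi U t);
  iso_scale : forall U s f, proj_open U -> sh_sec U s -> struct_sheaf U f ->
    sh_eq U (phi U (sh_scale s f)) (sh_scale (phi U s) f);
  iso_par : forall p U s, proj_open U -> sh_sec U s -> sh_par p U s ->
    sh_par p U (phi U s);
  iso_inj : forall U s t, proj_open U -> sh_sec U s -> sh_sec U t ->
    sh_eq U (phi U s) (phi U t) -> sh_eq U s t;
  iso_surj : forall U (t : F), proj_open U -> sh_sec U t ->
    exists2 s : E, sh_sec U s & sh_eq U (phi U s) t }.

Definition isomorphic (E F : osheaf) : Prop :=
  exists phi : set point -> E -> F, is_iso phi.

(* The line bundle with transition functions g i j on the charts: a section   *)
(* over U is a family s i of superfunctions on U `&` chart i such that        *)
(* s i = g i j * s j on overlaps.                                             *)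
Definition line_bundle (g : 'I_n.+1 -> 'I_n.+1 -> sfun) : osheaf := {|
  sh_car := ('I_n.+1 -> sfun : zmodType);
  sh_sec := fun U s =>
    (forall i, struct_sheaf (U `&` chart i) (s i)) /\
    (forall i j, eq_on (U `&` chart i `&` chart j) (s i) (g i j * s j));
  sh_eq := fun U s t => forall i, eq_on (U `&` chart i) (s i) (t i);
  sh_scale := fun s f i => s i * f;
  sh_par := fun p U s => forall i, has_parity p (U `&` chart i) (s i) |}.

(* O(l) on P^n, with frame x_i ^ l on chart i, and its pullback along the     *)
(* projection P^(n|m) -> P^n, which sends a function on P^n to the            *)
(* superfunction with this constant term.                                     *)
Definition twist_transition (l : int) i j : point -> K :=
  fun x => (x 0 j / x 0 i) ^ l.

Definition twisting_sheaf (l : int) : osheaf :=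
  line_bundle (fun i j x => gconst m (twist_transition l i j x)).

Definition family := set point -> sfun -> sfun.

(* Homogeneous superderivations of parity p of the structure sheaf over U:    *)
(* D V acts on the superfunctions on V.                                       *)
Record derivation (p : bool) U (D : family) : Prop := {
  der_sec : forall V f, proj_open V -> V `<=` U ->
    struct_sheaf V f -> struct_sheaf V (D V f);
  der_res : forall V W f g, proj_open V -> proj_open W -> V `<=` U ->
    W `<=` V -> struct_sheaf V f -> struct_sheaf W g -> eq_on W f g ->
    eq_on W (D V f) (D W g);
  der_add : forall V f g, proj_open V -> V `<=` U ->
    struct_sheaf V f -> struct_sheaf V g ->
    eq_on V (D V (f + g)) (D V f + D V g);
  der_const : forall V (k : K) f, proj_open V -> V `<=` U ->
    struct_sheaf V f ->
    eq_on V (D V (cst (gconst m k) * f)) (cst (gconst m k) * D V f);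
  der_par : forall V q f, proj_open V -> V `<=` U ->
    struct_sheaf V f -> has_parity q V f -> has_parity (p (+) q) V (D V f);
  der_leibniz : forall V q f g, proj_open V -> V `<=` U ->
    struct_sheaf V f -> has_parity q V f -> struct_sheaf V g ->
    eq_on V (D V (f * g)) (D V f * g + (-1) ^+ (p && q) * f * D V g) }.

Definition der_eq U (D D' : family) : Prop :=
  forall V f, proj_open V -> V `<=` U -> struct_sheaf V f ->
    eq_on V (D V f) (D' V f).

Definition tangent U (D : family) : Prop :=
  exists D0 D1 : family,
    [/\ derivation false U D0, derivation true U D1 & der_eq U D (D0 + D1)].

(* The cotangent sheaf: morphisms w from the tangent sheaf to the structure   *)
(* sheaf that are linear for the left module structure of the former. It is a *)
(* right module by (w f)(D) = w(D) f, so that d f = (D |-> D f) and           *)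
(*   d y_b = \sum_a d x_a * (partial y_b / partial x_a)                       *)
(* without signs.                                                             *)
Record is_form U (w : set point -> family -> sfun) : Prop := {
  form_sec : forall V D, proj_open V -> V `<=` U ->
    tangent V D -> struct_sheaf V (w V D);
  form_res : forall V W D D', proj_open V -> proj_open W -> V `<=` U ->
    W `<=` V -> tangent V D -> tangent W D' -> der_eq W D D' ->
    eq_on W (w V D) (w W D');
  form_add : forall V D D', proj_open V -> V `<=` U ->
    tangent V D -> tangent V D' -> eq_on V (w V (D + D')) (w V D + w V D');
  form_scale : forall V f D, proj_open V -> V `<=` U ->
    struct_sheaf V f -> tangent V D ->
    eq_on V (w V (fun W g => f * D W g)) (f * w V D) }.

Definition cotangent : osheaf := {|
  sh_car := (set point -> family -> sfun : zmodType);
  sh_sec := is_form;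
  sh_eq := fun U w w' => forall V D, proj_open V -> V `<=` U -> tangent V D ->
    eq_on V (w V D) (w' V D);
  sh_scale := fun w f V D => w V D * f;
  sh_par := fun p U w => forall V q D, proj_open V -> V `<=` U ->
    derivation q V D -> has_parity (p (+) q) V (w V D) |}.

Definition differential f : cotangent := fun V D => D V f.

(* The transition matrices T i j of a sheaf with frames e i over chart i:     *)
(*   e j b = \sum_a e i a * T i j a b  over chart i `&` chart j,              *)
(* with superfunctions as entries; the values of T i j off the overlap are    *)
(* irrelevant.                                                                *)
Definition transition (E : osheaf) (N : nat) (e : 'I_n.+1 -> 'I_N -> E) i j :
    point -> 'M[grassmann K m]_N :=
  xget (fun=> 0) [set T : point -> 'M[grassmann K m]_N |
    (forall a b, struct_sheaf (chart i `&` chart j) (fun x => T x a b)) /\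
    (forall b, sh_eq (chart i `&` chart j) (e j b)
                 (\sum_(a < N) sh_scale (e i a) (fun x => T x a b)))].

(* The Berezinian sheaf of a locally free sheaf of rank p|q given with frames *)
(* over the charts, the first p elements even and the last q odd.             *)
Definition Ber (E : osheaf) (p q : nat) (e : 'I_n.+1 -> 'I_(p + q) -> E) :
    osheaf :=
  line_bundle (fun i j x => berezinian (transition e i j x)).

Definition cotangent_frame i (a : 'I_(n + m)) : cotangent :=
  differential (coord i a).

End ProjectiveSuperspace.

(* Main.v *)
From HB Require Import structures.
Require Import Defs.
From mathcomp Require Import all_boot all_order all_algebra.
From mathcomp Require Import complex reals.
From mathcomp Require Import ring.
Import GRing.Theory Num.Theory.
Local Open Scope ring_scope.

Set Implicit Arguments.
Unset Strict Implicit.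
Unset Printing Implicit Defensive.

(** The two line bundles have the same transition functions up to a coboundary
    of signs, so rescaling the section on chart i by (-1)^i is an isomorphism
    ([line_bundle_iso]). All the work is in computing the Berezinian of the
    transition matrices of the cotangent sheaf.

    Write u = x_j / x_i on the overlap of charts i and j. The coordinates of
    chart j satisfy u z^j = z^i and u theta^j = theta^i, where z^j and z^i are
    the same homogeneous coordinate divided by x_j and by x_i. A tangent field
    D obeys the Leibniz rule, u is even and constants are killed, hence
      D z^j = (D z^i - (D u) z^j) / u,
      D theta^j = (D theta^i - (D u) theta^j) / u.
    No Taylor expansion is needed, since the change of coordinates is rational.
    These identities exhibit an explicit transition matrix ([jacobian],
    [jacobian_transition]). It is the only one ([transition_unique]), because
    the coordinate differentials on a chart admit a dual family of tangent
    fields ([dual_derivation]): in homogeneous coordinates the fields d/dz_k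
    and d/dtheta_b of chart i are x_i d/dx_c and x_i d/dxi_b. That they are
    superderivations of the structure sheaf rests on the Leibniz rule in the
    Grassmann algebra ([gderiv_leibniz]) and on the closure of holomorphic
    functions under products and partial derivatives.

    The matrix is block upper triangular, the even coordinates of chart j being
    free of odd variables. Its odd block is u^-1 times the identity, which
    contributes u^m to the Berezinian, and its even block is the classical
    Jacobian of the change of chart on the projective space, with determinant
    (-1)^(i + j) u^(-n - 1). The latter is u^-n times a minor of a rank two
    perturbation of the identity ([det_minor_1Drank2]). Altogether the
    Berezinian is (-1)^(i + j) u^(m - n - 1). *)

(** * The Grassmann algebra and its odd derivatives *)

Section Grassmann_theory.
Variables (K : numFieldType) (m : nat).
Implicit Types (a c : grassmann K m) (k l : K) (A B C : {set 'I_m}).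

Lemma grassmannP a c : (forall A, a A = c A) -> a = c.
Proof. by move=> ac; apply: val_inj; apply/ffunP. Qed.

Lemma gcoef0 A : (0 : grassmann K m) A = 0. Proof. by rewrite ffunE. Qed.
Lemma gcoefD a c A : (a + c) A = a A + c A. Proof. by rewrite ffunE. Qed.
Lemma gcoefN a A : (- a) A = - a A. Proof. by rewrite ffunE. Qed.
Lemma gcoefM a c A : (a * c) A = \sum_(B : {set 'I_m} | B \subset A)
  (-1) ^+ ginversions B (A :\: B) * (a B * c (A :\: B)).
Proof. by rewrite ffunE. Qed.
Lemma gconstE k A : gconst m k A = if A == set0 then k else 0.
Proof. by rewrite ffunE. Qed.
Lemma ggenE (b : 'I_m) A : ggen K b A = (A == [set b])%:R.
Proof. by rewrite ffunE. Qed.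

Lemma gcoef_gconstM k a A : (gconst m k * a) A = k * a A.
Proof.
rewrite gcoefM (bigD1 set0) ?sub0set //= big1 => [|B /andP[_ /negPf B0]].
  by rewrite gconstE eqxx setD0 addr0 /ginversions big_set0 mul1r.
by rewrite gconstE B0 mul0r mulr0.
Qed.

Lemma gconstMC k a : gconst m k * a = a * gconst m k.
Proof.
apply: grassmannP => A; rewrite gcoef_gconstM gcoefM.
rewrite (bigD1 A) //= big1 => [|B /andP[sBA BA]].
  rewrite gconstE setDv eqxx addr0 /ginversions big1 ?mul1r 1?mulrC // => i _.
  by rewrite big_set0.
rewrite gconstE setD_eq0; case: ifPn => [sAB|_]; last by rewrite !mulr0.
by move: BA; rewrite eqEsubset sBA sAB.
Qed.

Lemma gconst_is_zmod : zmod_morphism (gconst (K := K) m).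
Proof.
move=> k l; apply: grassmannP => A; rewrite gcoefD gcoefN !gconstE.
by case: ifP; rewrite ?subr0.
Qed.

Lemma gconst_is_monoid : monoid_morphism (gconst (K := K) m).
Proof.
split=> // k l; apply: grassmannP => A.
by rewrite gcoef_gconstM !gconstE; case: ifP; rewrite ?mulr0.
Qed.

HB.instance Definition _ :=
  GRing.isZmodMorphism.Build K (grassmann K m) (gconst m) gconst_is_zmod.
HB.instance Definition _ :=
  GRing.isMonoidMorphism.Build K (grassmann K m) (gconst m) gconst_is_monoid.

(** The left derivative with respect to xi_b: the sign moves xi_b to the front
    of the monomial indexed by b |: A, before it is removed. *)
Definition gderiv (b : 'I_m) a : grassmann K m :=
  Grassmann [ffun A : {set 'I_m} =>
    if b \in A then 0 else (-1) ^+ ginversions [set b] A * a (b |: A)].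

Lemma gderivE b a A : gderiv b a A =
  if b \in A then 0 else (-1) ^+ ginversions [set b] A * a (b |: A).
Proof. by rewrite ffunE. Qed.

Lemma gderivD b a c : gderiv b (a + c) = gderiv b a + gderiv b c.
Proof.
apply: grassmannP => A; rewrite gcoefD !gderivE gcoefD.
by case: ifP; rewrite ?addr0 // mulrDr.
Qed.

Lemma gderiv_gconstM b k a :
  gderiv b (gconst m k * a) = gconst m k * gderiv b a.
Proof.
apply: grassmannP => A; rewrite gcoef_gconstM !gderivE gcoef_gconstM.
by case: ifP; rewrite ?mulr0 // mulrCA.
Qed.

Lemma gderiv_gconst b k : gderiv b (gconst m k) = 0.
Proof.
apply: grassmannP => A; rewrite gderivE gcoef0 gconstE.
by case: ifP => // bA; rewrite -cards_eq0 cardsU1 bA /= mulr0.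
Qed.

Lemma gderiv_ggen b b' : gderiv b (ggen K b') = (b == b')%:R.
Proof.
apply: grassmannP => A; rewrite gderivE ggenE.
rewrite -(rmorph_nat (gconst m)) gconstE.
have [->|[i iA]] := set_0Vmem A.
  rewrite inE eqxx setU0 /ginversions (eq_bigr (fun=> 0%N)) => [|i _].
    by rewrite big1 // mul1r; congr (_ %:R); rewrite (inj_eq set1_inj).
  by rewrite big_set0.
have /negPf-> : A != set0 by apply/set0Pn; exists i.
case: ifPn => // bA; have bi : b != i by apply: contraNneq bA => ->.
suff /negPf-> : b |: A != [set b'] by rewrite mulr0.
apply: contraNneq bi => e.
have /set1P-> : b \in [set b'] by rewrite -e !inE eqxx.
have /set1P-> // : i \in [set b'] by rewrite -e !inE iA orbT.
Qed.

(** Subsets of b |: A either avoid b or contain it; the Leibniz rule compares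
    the two halves. *)
Lemma sum_subset_setU1 b A (F : {set 'I_m} -> K) : b \notin A ->
  \sum_(B : {set 'I_m} | B \subset b |: A) F B =
  \sum_(B : {set 'I_m} | B \subset A) F B +
  \sum_(B : {set 'I_m} | B \subset A) F (b |: B).
Proof.
move=> bA; rewrite (bigID (fun B : {set 'I_m} => b \notin B)) /=; congr (_ + _).
  apply: eq_bigl => B; apply/andP/idP => [[sB bB]|sB].
    apply/subsetP => i iB; have := subsetP sB i iB.
    rewrite !inE => /predU1P[ib|//].
    by rewrite -ib iB in bB.
  split; first exact: subset_trans sB (subsetUr _ _).
  by apply: contra bA => /(subsetP sB).
rewrite (reindex_onto (fun B => b |: B) (fun B => B :\ b)) /=; last first.
  by move=> B /andP[_ /negPn bB]; rewrite setD1K.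
apply: eq_bigl => B; rewrite setU11 andbT.
apply/andP/idP => [[sB /eqP eB]|sB].
  apply/subsetP => i iB; have := subsetP sB i; rewrite !inE iB orbT => /(_ isT).
  by case/predU1P => // ib; move: iB; rewrite -eB ib !inE eqxx.
by rewrite setUS // setU1K //; apply: contra bA => /(subsetP sB).
Qed.

(** Moving xi_b across a monomial xi_B costs one sign for each factor, since
    each factor is inverted with b on exactly one side. *)
Lemma ginversions_set1 b B : b \notin B ->
  (ginversions [set b] B + ginversions B [set b] = #|B|)%N.
Proof.
move=> bB; rewrite /ginversions big_set1 -big_split /= -sum1_card.
apply: eq_bigr => i iB; rewrite big_set1.
by have [||/val_inj e] := ltngtP; rewrite // -e iB in bB.
Qed.

(** Coefficientwise, both sides are sums over the splittings of the monomial.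
    At a monomial without xi_b, the splittings of b |: A for which xi_b lies in
    the left factor give the first term on the right, and the others give the
    second one. At a monomial with xi_b the left side vanishes, and the two
    terms on the right cancel in pairs. *)
Lemma gderiv_leibniz b (q : bool) a c :
  (forall A, odd #|A| != q -> a A = 0) ->
  gderiv b (a * c) = gderiv b a * c + (-1) ^+ q * a * gderiv b c.
Proof.
move=> a_q; pose s := ginversions [set b].
have sgnP n : (-1) ^+ n = 1 :> K \/ (-1) ^+ n = -1 :> K.
  by rewrite -signr_odd; case: (odd n); [right | left].
have sgn_a B : ((-1) ^+ q * a) B = (-1) ^+ #|B| * a B.
  rewrite -(rmorph_sign (gconst m)) gcoef_gconstM.
  have [<-|/a_q->] := eqVneq (odd #|B|) q; first by rewrite signr_odd.
  by rewrite !mulr0.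
apply: grassmannP => A0; rewrite gcoefD !gcoefM gderivE gcoefM.
(* A denotes the monomial deprived of xi_b in both cases. *)
wlog [A [bA eA0]] : A0 / exists A, b \notin A /\ (A0 = A \/ A0 = b |: A).
  move=> IH; apply: IH; exists (A0 :\ b); split; first by rewrite !inE eqxx.
  have [bA0|bA0] := boolP (b \in A0); first by right; rewrite setD1K.
  by left; apply/setP => i; rewrite !inE; case: eqVneq => // ->; apply: negbTE.
have nb B : B \subset A -> b \notin B.
  by move=> sB; apply: contra bA => /(subsetP sB).
have nbD B : b \notin A :\: B by rewrite inE negb_and bA orbT.
have setD_l B : B \subset A -> (b |: A) :\: B = b |: (A :\: B).
  move=> /nb bB; apply/setP => i; rewrite !inE.
  by case: eqVneq => [->|]; rewrite ?bB.
have setD_lr B : (b |: A) :\: (b |: B) = A :\: B.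
  apply/setP => i; rewrite !inE.
  by case: eqVneq => [->|]; rewrite ?(negPf bA) ?andbF.
have inv_l B C : b \notin B ->
    ginversions (b |: B) C = (s C + ginversions B C)%N.
  by move=> bB; rewrite ginversions_setUl // disjoints1.
have inv_r B C : b \notin C ->
    ginversions B (b |: C) = (ginversions B [set b] + ginversions B C)%N.
  by move=> bC; rewrite ginversions_setUr // disjoints1.
have sA B : B \subset A -> s A = (s B + s (A :\: B))%N.
  move=> sB; rewrite -ginversions_setUr; last first.
    by rewrite -setI_eq0 setIDA setIC -setIDA setDv setI0.
  by rewrite -{1}(setID A B) (setIidPr sB).
have cardB B : B \subset A ->
    (-1) ^+ #|B| = (-1) ^+ s B * (-1) ^+ ginversions B [set b] :> K.
  by move=> /nb/ginversions_set1 <-; rewrite exprD.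
case: eA0 => ->{A0}.
  rewrite (negPf bA) sum_subset_setU1 // addrC mulrDr !mulr_sumr.
  congr (_ + _); apply: eq_bigr => B sB.
    rewrite setD_lr gderivE (negPf (nb _ sB)) inv_l ?nb // -/(s _) (sA _ sB).
    rewrite !exprD; case: (sgnP (s (A :\: B))) => ->; ring.
  rewrite setD_l // gderivE (negPf (nbD _)) inv_r // -/(s _) (sA _ sB) sgn_a.
  rewrite cardB // !exprD.
  by case: (sgnP (ginversions B [set b])) => ->; ring.
rewrite setU11 !sum_subset_setU1 //.
rewrite [X in _ + X + _]big1 => [|B sB]; last first.
  by rewrite gderivE setU11 mul0r mulr0.
rewrite [X in _ + (X + _)]big1 => [|B sB]; last first.
  by rewrite setD_l // gderivE setU11 !mulr0.
rewrite addr0 add0r -big_split big1 //= => B sB.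
rewrite setD_lr setD_l // !gderivE (negPf (nb _ sB)) (negPf (nbD _)) sgn_a.
rewrite cardsU1 nb // inv_l ?nb // inv_r // -!/(s _) exprS cardB // !exprD.
case: (sgnP (s (A :\: B))) => ->; case: (sgnP (s B)) => ->; ring.
Qed.

End Grassmann_theory.

(** * The determinant of a change of affine chart *)

Section Determinant.
Variable (R : comNzRingType).

(** Sylvester's identity: both sides are the determinant of the block matrix M,
    factored in the two possible ways into block triangular matrices. *)
Lemma det_1DM_swap p q (U : 'M[R]_(p, q)) (V : 'M[R]_(q, p)) :
  \det (1%:M + U *m V) = \det (1%:M + V *m U).
Proof.
pose L := block_mx 1%:M 0 V 1%:M : 'M[R]_(p + q).
pose M := block_mx 1%:M (- U) V 1%:M : 'M[R]_(p + q).
have e1 : M = block_mx 1%:M (- U) 0 1%:M *m block_mx (1%:M + U *m V) 0 V 1%:M.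
  rewrite mulmx_block !(mul1mx, mulmx1, mul0mx, mulmx0, add0r).
  by rewrite mulNmx addrK.
have e2 : M = L *m block_mx 1%:M (- U) 0 (1%:M + V *m U).
  rewrite mulmx_block !(mul1mx, mulmx1, mul0mx, mulmx0, add0r, addr0).
  by rewrite mulmxN addrC addrK.
have := congr1 determinant e2; rewrite e1 !det_mulmx !det_ublock !det_lblock.
by rewrite !det1 !mul1r !mulr1.
Qed.

Lemma det_block11 (a b c d : 'M[R]_1) :
  \det (block_mx a b c d) = a 0 0 * d 0 0 - b 0 0 * c 0 0.
Proof.
rewrite (expand_det_row _ (lshift 1 0)) big_split_ord !big_ord1 /cofactor.
rewrite !det_mx11 !mxE.
have -> : lift (lshift 1 (0 : 'I_1)) 0 = rshift 1 0 :> 'I_(1 + 1).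
  by apply: val_inj.
have -> : lift (rshift 1 (0 : 'I_1)) 0 = lshift 1 0 :> 'I_(1 + 1).
  by apply: val_inj.
rewrite !(unsplitK (inl _), unsplitK (inr _)) !mxE.
by rewrite !(unsplitK (inl _), unsplitK (inr _)) /= expr0 expr1; ring.
Qed.

(** The matrix is obtained from Q = 1 - e_j w by deleting row i and column j.
    As w j = 1, the column j of Q vanishes, so adding e_i e_j^T to Q puts a
    single 1 in that column without changing the minor. The sum is a rank two
    perturbation of the identity, whose determinant is a 2 x 2 one. *)
Lemma det_minor_1Drank2 n (i j : 'I_n.+1) (w : 'I_n.+1 -> R) : w j = 1 ->
  \det (\matrix_(a < n, k < n)
     ((lift i a == lift j k)%:R - (lift i a == j)%:R * w (lift j k))) =
  (-1) ^+ (i + j) * w i.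
Proof.
move=> wj.
pose P : 'M[R]_n.+1 := 1%:M + row_mx (- delta_mx j 0) (delta_mx i 0) *m
  col_mx (\row_c w c) (delta_mx 0 j : 'rV_n.+1) :> 'M[R]_n.+1.
have PE r c :
    P r c = (r == c)%:R - (r == j)%:R * w c + (r == i)%:R * (c == j)%:R.
  by rewrite /P mul_row_col mulNmx !mxE !big_ord1 !mxE !eqxx !andbT addrA.
have detP : \det P = w i.
  rewrite det_1DM_swap mul_col_row scalar_mx_block add_block_mx det_block11.
  rewrite !mulmxN -!rowE -!colE !mxE !eqxx wj subrr mul0r sub0r !add0r.
  by rewrite mulrN1 opprK.
have : \det P = (-1) ^+ (i + j) * \det (row' i (col' j P)).
  rewrite (expand_det_col _ j) (bigD1 i) //= big1 ?addr0 => [|r /negPf ri].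
    by rewrite PE wj eqxx mulr1 subrr add0r eqxx !mul1r.
  by rewrite PE wj ri mul0r addr0 mulr1 subrr mul0r.
rewrite detP => ->; rewrite mulrA -expr2 sqrr_sign mul1r.
congr (\det _); apply/matrixP => a k; rewrite mxE [RHS]mxE [RHS]mxE PE.
by rewrite [lift j k == j]eq_sym (negPf (neq_lift _ _)) mulr0 addr0.
Qed.

End Determinant.

(** * Holomorphic functions *)

From mathcomp Require Import boolp classical_sets functions.
From mathcomp Require Import topology normedtype landau derive.
(* From here on, proj_open denotes the scaling-invariant open sets again, not
   the openness of the projections of a product. *)
Import Defs.
Import numFieldNormedType.Exports.
Local Open Scope classical_set_scope.

(** A first-order expansion of f at x is one of g, as it only involves the
    germ. *)
Lemma near_eq_differentiable (K : numFieldType) (V W : normedModType K)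
    (f g : V -> W) (x : V) :
  (\near x, f x = g x) -> differentiable f x -> differentiable g x.
Proof.
move=> fg df; have [dc /eqaddoP fo] := (diff_locallyP x f).1 df.
have fgx := nbhs_singleton fg.
have go : g \o shift x = cst (g x) + 'd f x +o_ 0 id.
  apply/eqaddoP => e e0; have fo_e := fo e e0.
  have fg0 : \forall h \near (0 : V), f (h + x) = g (h + x).
    by move: fg; rewrite (near_shift 0) /= subr0.
  rewrite /= !fctE /= in fo_e *; apply: filterS2 fo_e fg0 => h /=.
  by move=> + fgh; rewrite fgh fgx.
have dE := diff_unique dc go.
by apply/diff_locallyP; rewrite dE.
Qed.

Section Kdiff_theory.
Variables (K : numFieldType) (N : nat).
Implicit Types (U V : set 'rV[K]_N) (f g : 'rV[K]_N -> K) (k : nat).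

Lemma open_near U x : open U -> U x -> \forall y \near x, U y.
Proof. by move=> Uo Ux; apply: open_nbhs_nbhs. Qed.

Lemma Kdiff_differentiable k U f x : Kdiff k U f -> U x -> differentiable f x.
Proof. by case: k => [|k] [df _]; exact: df. Qed.

Lemma KdiffS k U f : Kdiff k.+1 U f -> Kdiff k U f.
Proof.
elim: k f => [|k IH] f [df Df]; first by split.
by split=> // i; apply: IH.
Qed.

Lemma Kdiff_sub k U V f : V `<=` U -> Kdiff k U f -> Kdiff k V f.
Proof.
move=> VU; elim: k f => [|k IH] f [df Df]; first by split=> // x /VU/df.
by split=> [x /VU/df //|i]; exact/IH/Df.
Qed.

Lemma derive_congr_open U f g v x : open U -> {in U, f =1 g} -> U x ->
  'D_v f x = 'D_v g x.
Proof.
move=> Uo fg Ux; apply: near_eq_derive.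
apply: filterS (open_near Uo Ux) => y Uy.
by apply: fg; rewrite inE.
Qed.

(** The derivatives in Kdiff are total functions, for which the usual formulas
    hold on U only; this lemma is what lets these formulas be used. *)
Lemma Kdiff_congr k U f g : open U -> {in U, f =1 g} ->
  Kdiff k U f -> Kdiff k U g.
Proof.
move=> Uo; elim: k f g => [|k IH] f g fg [df Df].
  split=> // x Ux; apply: near_eq_differentiable (df x Ux).
  by apply: filterS (open_near Uo Ux) => y Uy; apply: fg; rewrite inE.
split=> [x Ux|i].
  apply: near_eq_differentiable (df x Ux).
  by apply: filterS (open_near Uo Ux) => y Uy; apply: fg; rewrite inE.
apply: IH (Df i) => x; rewrite inE => Ux.
exact: derive_congr_open Ux.
Qed.

Lemma Kdiff_cst k U (c : K) : Kdiff k U (cst c).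
Proof.
elim: k c => [|k IH] c; split=> // i.
rewrite (_ : 'D_(delta_mx 0 i) (cst c) = cst 0) //.
by apply/funext => x; rewrite derive_cst.
Qed.

Lemma Kdiff_add k U f g : open U ->
  Kdiff k U f -> Kdiff k U g -> Kdiff k U (f + g).
Proof.
move=> Uo; elim: k f g => [|k IH] f g [df Df] [dg Dg].
  by split=> // x Ux; apply: differentiableD; [exact: df | exact: dg].
split=> [x Ux|i].
  by apply: differentiableD; [exact: df | exact: dg].
apply: (Kdiff_congr _ _ (IH _ _ (Df i) (Dg i))) => // x; rewrite inE => Ux.
by rewrite deriveD //; apply: diff_derivable; [exact: df | exact: dg].
Qed.

Lemma Kdiff_mul k U f g : open U ->
  Kdiff k U f -> Kdiff k U g -> Kdiff k U (f * g).
Proof.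
move=> Uo; elim: k f g => [|k IH] f g Kf Kg.
  by split=> // x Ux; apply: differentiableM;
    [exact: Kdiff_differentiable Kf Ux | exact: Kdiff_differentiable Kg Ux].
split=> [x Ux|i].
  by apply: differentiableM;
    [exact: Kdiff_differentiable Kf Ux | exact: Kdiff_differentiable Kg Ux].
apply: (@Kdiff_congr k U
  (f * 'D_(delta_mx 0 i) g + g * 'D_(delta_mx 0 i) f)) => //.
  move=> x; rewrite inE => Ux; rewrite deriveM //; apply: diff_derivable;
    [exact: Kdiff_differentiable Kf Ux | exact: Kdiff_differentiable Kg Ux].
by apply: Kdiff_add => //; apply: IH; do ?[exact: KdiffS];
  [exact: (Kg.2 i) | exact: (Kf.2 i)].
Qed.

Lemma Kdiff_inv k U f : open U -> (forall x, U x -> f x != 0) ->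
  Kdiff k U f -> Kdiff k U (fun x => (f x)^-1).
Proof.
move=> Uo f0; elim: k => [|k IH] Kf.
  split=> // x Ux; apply: differentiableV; last exact: f0.
  exact: Kdiff_differentiable Kf Ux.
have Ki := IH (KdiffS Kf); split=> [x Ux|i].
  by apply: differentiableV; [exact: Kdiff_differentiable Kf Ux|exact: f0].
apply: (@Kdiff_congr k U
  (cst (-1) * ((fun x => (f x)^-1) * (fun x => (f x)^-1) *
    'D_(delta_mx 0 i) f))) => //.
  move=> x; rewrite inE => Ux; rewrite deriveV; first last.
  - by apply: diff_derivable; exact: Kdiff_differentiable Kf Ux.
  - exact: f0.
  by rewrite !fctE mulN1r -scaleNr -expr2 exprVn.
apply: Kdiff_mul => //; first exact: Kdiff_cst.
by apply: Kdiff_mul => //; [exact: Kdiff_mul | exact: (Kf.2 i)].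
Qed.

Lemma derive_coord (c : 'I_N) v x : 'D_v (fun y : 'rV[K]_N => y 0 c) x = v 0 c.
Proof.
pose p (y : 'rV[K]_N) : K := y 0 c.
have pl : linear p by move=> a y z; rewrite /p !mxE.
pose pL : {linear 'rV[K]_N -> K} :=
  HB.pack p (GRing.isLinear.Build _ _ _ _ _ pl).
by rewrite deriveE ?(@diff_lin _ _ _ pL); [| exact: coord_continuous |
  exact: differentiable_coord].
Qed.

Lemma Kdiff_coord k U (c : 'I_N) : Kdiff k U (fun x => x 0 c).
Proof.
case: k => [|k]; first by split=> // x _; exact: differentiable_coord.
split=> [x _|i]; first exact: differentiable_coord.
rewrite (_ : 'D_(delta_mx 0 i) _ = cst ((delta_mx 0 i : 'rV[K]_N) 0 c)).
  exact: Kdiff_cst.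
by apply/funext => x; rewrite derive_coord.
Qed.

(** Chain rule for a homothety; it makes partial derivatives homogeneous. *)
Lemma derive_scale f (l : K) v x : differentiable f (l *: x) ->
  'D_v (fun y => f (l *: y)) x = l * 'D_v f (l *: x).
Proof.
move=> df.
have dl : differentiable ( *:%R l : 'rV[K]_N -> 'rV[K]_N) x.
  by apply: ex_diff.
have dfl : differentiable (f \o *:%R l) x by apply: differentiable_comp.
rewrite (deriveE v dfl) diff_comp // deriveE //= diff_val.
by rewrite linearZ.
Qed.

End Kdiff_theory.

Section Holomorphic.
Variables (K : numFieldType) (N : nat).
Implicit Types (U V : set 'rV[K]_N) (f g : 'rV[K]_N -> K).

Lemma holomorphic_sub U V f : V `<=` U -> holomorphic U f -> holomorphic V f.
Proof. by move=> VU hf k; exact: Kdiff_sub VU (hf k). Qed.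

Lemma holomorphic_congr U f g : open U -> {in U, f =1 g} ->
  holomorphic U f -> holomorphic U g.
Proof. by move=> Uo fg hf k; exact: Kdiff_congr Uo fg (hf k). Qed.

Lemma holomorphic_cst U (c : K) : holomorphic U (cst c).
Proof. by move=> k; exact: Kdiff_cst. Qed.

Lemma holomorphic_add U f g : open U ->
  holomorphic U f -> holomorphic U g -> holomorphic U (fun x => f x + g x).
Proof. by move=> Uo hf hg k; exact: Kdiff_add. Qed.

Lemma holomorphic_mul U f g : open U ->
  holomorphic U f -> holomorphic U g -> holomorphic U (fun x => f x * g x).
Proof. by move=> Uo hf hg k; exact: Kdiff_mul. Qed.

Lemma holomorphic_inv U f : open U -> (forall x, U x -> f x != 0) ->
  holomorphic U f -> holomorphic U (fun x => (f x)^-1).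
Proof. by move=> Uo f0 hf k; exact: Kdiff_inv. Qed.

Lemma holomorphic_coord U (c : 'I_N) : holomorphic U (fun x => x 0 c).
Proof. by move=> k; exact: Kdiff_coord. Qed.

Lemma holomorphic_derive U f (c : 'I_N) :
  holomorphic U f -> holomorphic U ('D_(delta_mx 0 c) f).
Proof. by move=> hf k; exact: (hf k.+1).2. Qed.

Lemma holomorphic_derivable U f v x :
  holomorphic U f -> U x -> derivable f x v.
Proof.
by move=> hf Ux; apply: diff_derivable; exact: Kdiff_differentiable (hf 0%N) Ux.
Qed.

End Holomorphic.

(** The derivative of a sum over the splittings of a monomial, which is indexed
    by a filtered finite type. *)
Lemma is_derive_bigsum (K : numFieldType) (V W : normedModType K) (I : Type)
    (r : seq I) (P : pred I) (F : I -> V -> W) (dF : I -> W) (x v : V) :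
  (forall i, P i -> is_derive x v (F i) (dF i)) ->
  is_derive x v (fun y => \sum_(i <- r | P i) F i y) (\sum_(i <- r | P i) dF i).
Proof.
move=> HF; elim: r => [|i r IH].
  rewrite big_nil (_ : (fun _ => _) = cst 0); first exact: is_derive_cst.
  by apply/funext => y; rewrite big_nil.
have [Pi|nPi] := boolP (P i); last first.
  rewrite big_cons (negPf nPi).
  rewrite (_ : (fun _ => _) = fun y => \sum_(i <- r | P i) F i y) //.
  by apply/funext => y; rewrite big_cons (negPf nPi).
rewrite big_cons Pi.
rewrite (_ : (fun _ => _) = F i + fun y => \sum_(i <- r | P i) F i y).
  by have := HF i Pi; move=> ?; exact: is_deriveD.
by apply/funext => y; rewrite big_cons Pi.
Qed.

(** * Sections of the structure sheaf *)

Section StructureSheaf.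
Variables (K : numFieldType) (n m : nat).
Local Notation point := 'rV[K]_n.+1.
Local Notation sfun := (point -> grassmann K m).
Implicit Types (U V W : set point) (f g : sfun) (i j c : 'I_n.+1).
Implicit Types (A : {set 'I_m}).

Lemma proj_open_open V : proj_open V -> open V. Proof. by case. Qed.

Lemma proj_open_scale V (l : K) x : proj_open V -> l != 0 -> V x -> V (l *: x).
Proof. by case=> _ _ h; exact: h. Qed.

Lemma proj_open_chart i : proj_open (@chart K n i).
Proof.
split.
- apply: (@open_comp _ _ (fun x : point => x 0 i) [set y | y != 0]).
    by move=> x _; exact: coord_continuous.
  rewrite (_ : [set y : K | y != 0] = ~` [set 0]).
    apply/closed_openC/accessible_closed_set1; exact: hausdorff_accessible.
  by apply/seteqP; split => y /= /eqP.
- by move=> x; apply: contraNneq => ->; rewrite mxE.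
- by move=> l x l0 xi; rewrite /chart /= mxE mulf_neq0.
Qed.

Lemma proj_openI U V : proj_open U -> proj_open V -> proj_open (U `&` V).
Proof.
move=> [Uo U0 Us] [Vo V0 Vs]; split; first exact: openI.
- by move=> x [/U0].
- by move=> l x l0 [Ux Vx]; split; [exact: Us | exact: Vs].
Qed.

Lemma struct_sheaf_congr V f g : proj_open V -> eq_on V f g ->
  struct_sheaf V f -> struct_sheaf V g.
Proof.
move=> pV fg [hf sf]; split=> [A|l x l0 Vx].
  apply: holomorphic_congr (hf A); first exact: proj_open_open.
  by move=> x; rewrite inE => Vx; rewrite fg.
by rewrite -!fg ?sf //; exact: proj_open_scale.
Qed.

Lemma scale_xiP (l : K) (a b : grassmann K m) :
  scale_xi l a = b <-> forall A : {set 'I_m}, l ^+ #|A| * a A = b A.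
Proof.
split=> [<- A|h]; first by rewrite ffunE.
by apply: grassmannP => A; rewrite ffunE h.
Qed.

Lemma struct_sheaf_coef V f (l : K) x A : struct_sheaf V f -> l != 0 -> V x ->
  l ^+ #|A| * f (l *: x) A = f x A.
Proof. by move=> [_ sf] l0 Vx; have /scale_xiP := sf l x l0 Vx. Qed.

(** For h homogeneous of degree -d and a of degree d in the odd variables, the
    two scalings compensate. *)
Lemma struct_sheaf_homog V (h : point -> K) (a : grassmann K m) (d : nat) :
  open V -> holomorphic V h ->
  (forall l x, l != 0 -> V x -> l ^+ d * h (l *: x) = h x) ->
  (forall A : {set 'I_m}, #|A| != d -> a A = 0) ->
  struct_sheaf V (fun x => gconst m (h x) * a).
Proof.
move=> Vo hh hs ha; split=> [A|l x l0 Vx].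
  rewrite (_ : (fun _ => _) = fun x => h x * cst (a A) x).
    by apply: holomorphic_mul => //; exact: holomorphic_cst.
  by apply/funext => x; rewrite gcoef_gconstM.
apply/scale_xiP => A; rewrite !gcoef_gconstM.
have [e|/ha ->] := eqVneq #|A| d; last by rewrite !mulr0.
by rewrite mulrA e hs.
Qed.

Lemma struct_sheaf_gconstM V (k : K) f : open V -> struct_sheaf V f ->
  struct_sheaf V (fun x => gconst m k * f x).
Proof.
move=> Vo sf; split=> [A|l x l0 Vx].
  rewrite (_ : (fun _ => _) = fun x => cst k x * f x A).
    by apply: holomorphic_mul => //; [exact: holomorphic_cst | exact: sf.1].
  by apply/funext => x; rewrite gcoef_gconstM.
by apply/scale_xiP => A; rewrite !gcoef_gconstM mulrCA (struct_sheaf_coef _ sf).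
Qed.

End StructureSheaf.

(** * The coordinate vector fields of a chart *)

Section CoordinateDerivations.
Variables (K : numFieldType) (n m : nat).
Local Notation point := 'rV[K]_n.+1.
Local Notation sfun := (point -> grassmann K m).
Implicit Types (U V W : set point) (f g : sfun) (i j c : 'I_n.+1).
Implicit Types (A B : {set 'I_m}).

Definition gpartial c f : sfun := fun x =>
  Grassmann [ffun A : {set 'I_m} => 'D_(delta_mx 0 c) (fun y => f y A) x].

Lemma gpartialE c f x A :
  gpartial c f x A = 'D_(delta_mx 0 c) (fun y => f y A) x.
Proof. by rewrite ffunE. Qed.

Lemma gpartialD c V f g x : struct_sheaf V f -> struct_sheaf V g -> V x ->
  gpartial c (f + g) x = gpartial c f x + gpartial c g x.
Proof.
move=> [hf _] [hg _] Vx; apply: grassmannP => A; rewrite gcoefD !gpartialE.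
rewrite -deriveD; [|exact: holomorphic_derivable Vx..].
by congr ('D_ _ _ x); apply/funext => y; rewrite gcoefD.
Qed.

Lemma gpartialM c V f g x : struct_sheaf V f -> struct_sheaf V g -> V x ->
  gpartial c (f * g) x = gpartial c f x * g x + f x * gpartial c g x.
Proof.
move=> [hf _] [hg _] Vx; apply: grassmannP => A.
rewrite gcoefD !gcoefM -big_split gpartialE /=.
pose F B := (-1) ^+ ginversions B (A :\: B) *:
  ((fun y => f y B) * (fun y => g y (A :\: B))) : point -> K.
rewrite (_ : (fun _ => _) = fun y => \sum_(B : {set 'I_m} | B \subset A) F B y);
  last by apply/funext => y; rewrite gcoefM.
have dF B : B \subset A -> is_derive x (delta_mx 0 c) (F B)
    ((-1) ^+ ginversions B (A :\: B) *:
      (f x B *: gpartial c g x (A :\: B) + g x (A :\: B) *: gpartial c f x B)).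
  move=> _; apply: is_deriveZ; rewrite !gpartialE; apply: is_deriveM;
    by apply: derivableP; exact: holomorphic_derivable Vx.
have -> := @derive_val _ _ _ _ _ _ _ (is_derive_bigsum (index_enum _) dF).
by apply: eq_bigr => B _; rewrite /= -mulrDr addrC [g x _ *: _]mulrC.
Qed.

Lemma gpartial_congr c V f g x : proj_open V -> eq_on V f g -> V x ->
  gpartial c f x = gpartial c g x.
Proof.
move=> pV fg Vx; apply: grassmannP => A; rewrite !gpartialE.
apply: (derive_congr_open _ (proj_open_open pV)) => // y.
by rewrite inE => Vy; rewrite fg.
Qed.

Lemma gpartial_gconstM c V (k : K) f x : struct_sheaf V f -> V x ->
  gpartial c (cst (gconst m k) * f) x = gconst m k * gpartial c f x.
Proof.
move=> [hf _] Vx; apply: grassmannP => A; rewrite gcoef_gconstM !gpartialE.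
rewrite (_ : (fun _ => _) = k *: (fun y => f y A)).
  by rewrite deriveZ //; exact: holomorphic_derivable Vx.
by apply/funext => y; rewrite gcoef_gconstM.
Qed.

(** Differentiating in a homogeneous coordinate lowers the degree by one; the
    factor x_i of the vector fields below restores it. *)
Lemma gpartial_homog c V f x A (l : K) : proj_open V -> struct_sheaf V f ->
  l != 0 -> V x -> l ^+ #|A|.+1 * gpartial c f (l *: x) A = gpartial c f x A.
Proof.
move=> pV sf l0 Vx; rewrite !gpartialE exprSr -mulrA -derive_scale; last first.
  by apply: Kdiff_differentiable (sf.1 A 0%N) _; exact: proj_open_scale.
rewrite -[LHS]deriveZ.
  apply: (derive_congr_open _ (proj_open_open pV)) => // y; rewrite inE => Vy.
  by rewrite -(struct_sheaf_coef A sf l0 Vy).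
apply: diff_derivable.
apply: (@differentiable_comp _ _ _ _ ( *:%R l) (fun y => f y A)).
  exact: ex_diff.
by apply: Kdiff_differentiable (sf.1 A 0%N) _; exact: proj_open_scale.
Qed.

(** For c <> i, this is the field d/dz of chart i, where z = x_c / x_i. *)
Definition even_der i c : family K n m := fun V f x =>
  gconst m (x 0 i) * gpartial c f x.

(** The field d/dtheta_b of chart i. *)
Definition odd_der i (b : 'I_m) : family K n m := fun V f x =>
  gconst m (x 0 i) * gderiv b (f x).

Lemma even_derivation U i c : derivation false U (even_der i c).
Proof.
split=> [V f pV _ sf|V W f g _ pW _ _ sf sg fg x Wx|V f g pV _ sf sg x Vx
  |V k f pV _ sf x Vx|V q f pV _ sf qf x A Vx qA|V q f g pV _ sf _ sg x Vx].
- split=> [A|l x l0 Vx].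
    rewrite (_ : (fun _ => _) = fun x : point =>
      x 0 i * 'D_(delta_mx 0 c) (fun y => f y A) x).
      apply: holomorphic_mul; first exact: proj_open_open.
        exact: holomorphic_coord.
      by apply: holomorphic_derive; exact: sf.1.
    by apply/funext => x; rewrite gcoef_gconstM gpartialE.
  apply/scale_xiP => A; rewrite !gcoef_gconstM mxE.
  by rewrite -(gpartial_homog c A pV sf l0 Vx) exprSr; ring.
- by rewrite /even_der (gpartial_congr c pW fg).
- by rewrite /even_der (gpartialD c sf sg Vx) mulrDr.
- rewrite /even_der (gpartial_gconstM c k sf Vx).
  by rewrite -[RHS]/(gconst m k * (gconst m (x 0 i) * _)) !mulrA (gconstMC k).
- rewrite gcoef_gconstM gpartialE.
  rewrite (derive_congr_open (g := cst 0) _ (proj_open_open pV)) //.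
    by rewrite derive_cst mulr0.
  by move=> y; rewrite inE => Vy; rewrite (qf y).
rewrite /even_der (gpartialM c sf sg Vx) /= mul1r mulrDr mulrA.
by congr (_ + _); rewrite !mulrA gconstMC.
Qed.

Lemma odd_derivation U i b : derivation true U (odd_der i b).
Proof.
split=> [V f pV _ sf|V W f g _ pW _ _ sf sg fg x Wx|V f g pV _ sf sg x Vx
  |V k f pV _ sf x Vx|V q f pV _ sf qf x A Vx qA|V q f g pV _ sf qf sg x Vx].
- have Vo := proj_open_open pV; split=> [A|l x l0 Vx].
    rewrite (_ : (fun _ => _) = fun x : point => x 0 i * (if b \in A then 0 else
        (-1) ^+ ginversions [set b]%SET A * f x (b |: A))).
      apply: holomorphic_mul => //; first exact: holomorphic_coord.
      case: (b \in A); first exact: holomorphic_cst.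
      by apply: holomorphic_mul => //; [exact: holomorphic_cst | exact: sf.1].
    by apply/funext => x; rewrite gcoef_gconstM gderivE.
  apply/scale_xiP => A; rewrite !gcoef_gconstM mxE !gderivE.
  case: ifPn => bA; first by rewrite !mulr0.
  rewrite -(struct_sheaf_coef (b |: A) sf l0 Vx) cardsU1 bA exprS; ring.
- by rewrite /odd_der fg.
- by rewrite /odd_der gderivD mulrDr.
- rewrite -[RHS]/(gconst m k * (gconst m (x 0 i) * _)) /odd_der.
  by rewrite gderiv_gconstM !mulrA (gconstMC k).
- rewrite gcoef_gconstM gderivE; case: ifPn => bA; first by rewrite mulr0.
  rewrite qf ?mulr0 // cardsU1 bA /=; move: qA.
  by case: (odd #|A|); case: q {qf}.
rewrite /odd_der (gderiv_leibniz b (q := q)); last by move=> A; exact: qf.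
rewrite -[RHS]/(gconst m (x 0 i) * gderiv b (f x) * g x +
  ((-1) ^+ q : sfun) x * f x * (gconst m (x 0 i) * gderiv b (g x))).
have -> : ((-1) ^+ q : sfun) x = (-1) ^+ q by case: (q).
by rewrite mulrDr !mulrA; congr (_ + _ * _); rewrite -!mulrA gconstMC !mulrA.
Qed.

Lemma derivation0 p U : derivation p U (0 : family K n m).
Proof.
split=> [V f pV _ _|V W f g *|V f g *|V k f *|V q f _ _ _ _ x A _ _
  |V q f g *] //.
- split=> [A|l x _ _]; last by apply/scale_xiP => A; rewrite gcoef0 mulr0.
  rewrite (_ : (fun _ => _) = cst 0); first exact: holomorphic_cst.
  by apply/funext => x; rewrite gcoef0.
- by move=> x _; rewrite addr0.
- by move=> x _; rewrite mulr0.
- by rewrite gcoef0.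
- by move=> x _; rewrite mul0r mulr0 addr0.
Qed.

Lemma tangent_even_der U i c : tangent U (even_der i c).
Proof.
exists (even_der i c), 0; split; first exact: even_derivation.
  exact: derivation0.
by move=> V f _ _ _ x _; rewrite addr0.
Qed.

Lemma tangent_odd_der U i b : tangent U (odd_der i b).
Proof.
exists 0, (odd_der i b); split; first exact: derivation0.
  exact: odd_derivation.
by move=> V f _ _ _ x _; rewrite add0r.
Qed.

End CoordinateDerivations.

(** * Tangent fields on affine coordinates *)

Section Tangent.
Variables (K : numFieldType) (n m : nat).
Variables (V : set 'rV[K]_n.+1) (D : family K n m).
Hypotheses (pV : proj_open V) (tD : tangent V D).
Local Notation sfun := ('rV[K]_n.+1 -> grassmann K m).
Implicit Types (f g : sfun).

Lemma tangent_congr f g : struct_sheaf V f -> eq_on V f g ->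
  eq_on V (D V f) (D V g).
Proof.
case: tD => D0 [D1 [dD0 dD1 eD]] sf fg x Vx.
have sg := struct_sheaf_congr pV fg sf.
rewrite !(eD _ _ pV _ _ x Vx) //=.
congr (_ + _); [exact: (der_res dD0 pV pV) | exact: (der_res dD1 pV pV)].
Qed.

(** For f even the sign of the Leibniz rule disappears, so that the rule holds
    for inhomogeneous tangent fields. *)
Lemma tangent_leibniz f g : struct_sheaf V f -> has_parity false V f ->
  struct_sheaf V g -> struct_sheaf V (f * g) ->
  eq_on V (D V (f * g)) (D V f * g + f * D V g).
Proof.
case: tD => D0 [D1 [dD0 dD1 eD]] sf ef sg sfg x Vx.
rewrite (eD _ _ pV _ sfg x Vx) //=.
rewrite -[LHS]/(D0 V (f * g) x + D1 V (f * g) x).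
rewrite (der_leibniz dD0 pV _ sf ef sg Vx) //.
rewrite (der_leibniz dD1 pV _ sf ef sg Vx) //.
rewrite -[RHS]/(D V f x * g x + f x * D V g x).
rewrite (eD _ _ pV _ sf x Vx) // (eD _ _ pV _ sg x Vx) //.
rewrite -[LHS]/(D0 V f x * g x + 1 * f x * D0 V g x +
  (D1 V f x * g x + 1 * f x * D1 V g x)).
by rewrite -[RHS]/((D0 V f x + D1 V f x) * g x + f x * (D0 V g x + D1 V g x))
  !mul1r mulrDl mulrDr addrACA.
Qed.

Lemma tangent1 : eq_on V (D V 1) 0.
Proof.
have s1 : struct_sheaf V (1 : sfun).
  split=> [A|l x _ _]; first exact: (holomorphic_cst V ((1 : grassmann K m) A)).
  apply/scale_xiP => A; rewrite !gconstE.
  by case: eqP => [->|_]; rewrite ?cards0 ?mulr1 ?mulr0.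
have e1 : has_parity false V (1 : sfun).
  move=> x A _ oA; rewrite gconstE; case: ifP => // /eqP A0.
  by rewrite A0 cards0 in oA.
move=> x Vx; have := tangent_leibniz s1 e1 s1; rewrite mulr1 => /(_ s1 x Vx).
rewrite -[in RHS]/(D V 1 x * 1 + 1 * D V 1 x) mulr1 mul1r => /eqP.
by rewrite -subr_eq subrr => /eqP <-.
Qed.

End Tangent.

Section Coordinates.
Variables (K : numFieldType) (n m : nat).
Local Notation point := 'rV[K]_n.+1.
Local Notation sfun := (point -> grassmann K m).
Implicit Types (V : set point) (i j c : 'I_n.+1).

(** The index c ranges over all homogeneous coordinates: the value c = i, where
    the coordinate is constantly 1, makes the change of charts uniform. *)
Definition even_coord i c : sfun := fun x => gconst m (x 0 c / x 0 i).

Definition odd_coord i (b : 'I_m) : sfun := fun x =>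
  gconst m (x 0 i)^-1 * ggen K b.

Lemma coord_lshift i (k : 'I_n) :
  @coord K n m i (lshift m k) = even_coord i (lift i k).
Proof. by apply/funext => x; rewrite /coord (unsplitK (inl _)). Qed.

Lemma coord_rshift i (b : 'I_m) : @coord K n m i (rshift n b) = odd_coord i b.
Proof. by apply/funext => x; rewrite /coord (unsplitK (inr _)). Qed.

Lemma holomorphic_coordV V i : open V -> V `<=` chart i ->
  holomorphic V (fun x => (x 0 i)^-1).
Proof.
move=> Vo Vi; apply: holomorphic_inv => //; exact: holomorphic_coord.
Qed.

Lemma even_coord_struct V i c : open V -> V `<=` chart i ->
  struct_sheaf V (even_coord i c).
Proof.
move=> Vo Vi;
rewrite (_ : even_coord i c = fun x => gconst m (x 0 c / x 0 i) * 1).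
  apply: (struct_sheaf_homog (d := 0)) => //.
  - apply: holomorphic_mul => //; first exact: holomorphic_coord.
    exact: holomorphic_coordV.
  - by move=> l x l0 _; rewrite mul1r !mxE invfM mulrACA divff ?mul1r.
  - by move=> A A0; rewrite gconstE -cards_eq0 (negPf A0).
by apply/funext => x; rewrite mulr1.
Qed.

Lemma odd_coord_struct V i b : open V -> V `<=` chart i ->
  struct_sheaf V (odd_coord i b).
Proof.
move=> Vo Vi; apply: (struct_sheaf_homog (d := 1)) => //.
- exact: holomorphic_coordV.
- by move=> l x l0 _; rewrite mxE invfM mulrA expr1 divff ?mul1r.
- by move=> A A1; rewrite ggenE; case: eqP => // A0; rewrite A0 cards1 in A1.
Qed.

Lemma even_coord_even V i c : has_parity false V (even_coord i c).
Proof.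
move=> x A _ oA; rewrite gconstE; case: ifP => // /eqP A0.
by rewrite A0 cards0 in oA.
Qed.

(** The change of coordinates from chart j to chart i on an open set contained
    in both, as seen by a tangent field. *)
Section Change.
Variables (i j : 'I_n.+1) (V : set point) (D : family K n m).
Hypotheses (pV : proj_open V) (Vi : V `<=` chart i) (Vj : V `<=` chart j).
Hypothesis tD : tangent V D.

Lemma even_coord_mulr x a b : V x -> a * even_coord i j x = b ->
  a = b * even_coord j i x.
Proof.
move=> Vx <-; rewrite -mulrA -rmorphM /= mulrA divfK ?divff ?rmorph1 ?mulr1 //.
  exact: Vj.
exact: Vi.
Qed.

Lemma tangent_even_coord_self : eq_on V (D V (even_coord i i)) 0.
Proof.
move=> x Vx; rewrite -(tangent1 pV tD Vx).
apply: (tangent_congr pV tD _ _ Vx).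
  exact: even_coord_struct (proj_open_open pV) Vi.
by move=> y /Vi yi; rewrite /even_coord divff // rmorph1.
Qed.

(** Leibniz rule on (x_j / x_i) * (x_c / x_j) = x_c / x_i, solved for the
    derivative of the second factor. *)
Lemma tangent_even_coord c x : V x ->
  D V (even_coord j c) x =
    (D V (even_coord i c) x - D V (even_coord i j) x * even_coord j c x) *
    even_coord j i x.
Proof.
move=> Vx; have Vo := proj_open_open pV; apply: even_coord_mulr => //.
have prod : eq_on V (even_coord i c) (even_coord i j * even_coord j c).
  move=> y Vy; rewrite -[RHS]/(_ y * _ y) -rmorphM /=.
  by congr gconst; rewrite [RHS]mulrC mulrA divfK //; exact: Vj.
have sc := even_coord_struct c Vo Vi.
have := tangent_congr pV tD sc prod Vx.
rewrite (tangent_leibniz pV tD) //; first last.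
- exact: struct_sheaf_congr prod sc.
- exact: even_coord_struct.
- exact: even_coord_even.
- exact: even_coord_struct.
move=> ->; rewrite -[X in X - _]/(D V (even_coord i j) x * _ + gconst m _ * _).
by rewrite addrC addKr gconstMC.
Qed.

Lemma tangent_odd_coord b x : V x ->
  D V (odd_coord j b) x =
    (D V (odd_coord i b) x - D V (even_coord i j) x * odd_coord j b x) *
    even_coord j i x.
Proof.
move=> Vx; have Vo := proj_open_open pV; apply: even_coord_mulr => //.
have prod : eq_on V (odd_coord i b) (even_coord i j * odd_coord j b).
  move=> y Vy; rewrite -[RHS]/(_ y * _ y) mulrA -rmorphM /=.
  by congr (gconst m _ * _); rewrite mulrAC divff ?mul1r //; exact: Vj.
have sc := odd_coord_struct b Vo Vi.
have := tangent_congr pV tD sc prod Vx.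
rewrite (tangent_leibniz pV tD) //; first last.
- exact: struct_sheaf_congr prod sc.
- exact: odd_coord_struct.
- exact: even_coord_even.
- exact: even_coord_struct.
move=> ->; rewrite -[X in X - _]/(D V (even_coord i j) x * _ + gconst m _ * _).
by rewrite addrC addKr gconstMC.
Qed.

End Change.

End Coordinates.

(** * The transition matrices of the cotangent sheaf *)

Section Jacobian.
Variables (K : numFieldType) (n m : nat).
Local Notation point := 'rV[K]_n.+1.
Implicit Types (U V : set point) (i j c : 'I_n.+1).

(** Column k holds the coefficients of d z_k, for the coordinate z_k of index
    lift j k on chart j, in the frame of chart i. If that index is i, then the
    first term vanishes, in agreement with z_k = 1 / u and
    d z_k = - d u / u^2, where u = x_j / x_i. *)
Definition even_jacobian i j (x : point) : 'M[K]_n :=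
  (x 0 i / x 0 j) *: \matrix_(a < n, k < n)
    ((lift i a == lift j k)%:R - (lift i a == j)%:R * (x 0 (lift j k) / x 0 j)).

Definition jacobian i j (x : point) : 'M[grassmann K m]_(n + m) :=
  block_mx (map_mx (gconst m) (even_jacobian i j x))
    (\matrix_(a < n, b < m)
      - ((lift i a == j)%:R * odd_coord j b x * even_coord m j i x))
    0 (map_mx (gconst m) (x 0 i / x 0 j)%:M).

(** The coordinate of index i is constant on chart i, so a tangent field is
    known on every coordinate from its values on the n affine ones. *)
Lemma sum_lift_delta i c (F : 'I_n.+1 -> grassmann K m) : F i = 0 ->
  \sum_(a < n) F (lift i a) * (lift i a == c)%:R = F c.
Proof.
move=> Fi; transitivity (\sum_d F d * (d == c)%:R).
  by rewrite (bigD1_ord i) //= Fi mul0r add0r.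
by rewrite (bigD1 c) //= eqxx mulr1 big1 ?addr0 // => d /negPf ->;
  rewrite mulr0.
Qed.

Definition frame_change i j (T : point -> 'M[grassmann K m]_(n + m)) : Prop :=
  forall b, sh_eq (chart i `&` chart j) (@cotangent_frame K n m j b)
    (\sum_(a < n + m) sh_scale (@cotangent_frame K n m i a) (fun x => T x a b)).

Lemma cotangent_sumE (N : nat) (F : 'I_N -> cotangent K n m) V D x :
  (\sum_(a < N) F a) V D x = \sum_(a < N) F a V D x.
Proof. by elim/big_rec2: _ => [|a u v _ <-]. Qed.

Lemma jacobian_transition i j : frame_change i j (jacobian i j).
Proof.
move=> b V D pV VO tD x Vx; rewrite cotangent_sumE.
have Vi : V `<=` chart i by move=> y /VO[].
have Vj : V `<=` chart j by move=> y /VO[].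
rewrite -[LHS]/(D V (coord j b) x).
rewrite -[RHS]/(\sum_(a < n + m) D V (coord i a) x * jacobian i j x a b).
have D0 := tangent_even_coord_self pV Vi tD Vx.
rewrite big_split_ord /=.
under eq_bigr do rewrite coord_lshift.
under [X in _ + X]eq_bigr do rewrite coord_rshift.
case: (split_ordP b) => k ->{b}.
  rewrite coord_lshift (tangent_even_coord pV Vi Vj) //.
  rewrite [RHS]addrC big1 ?add0r => [|a _]; last first.
    by rewrite block_mxEdl mxE mulr0.
  rewrite -(@sum_lift_delta i j (fun d => D V (even_coord m i d) x)) //.
  rewrite -(@sum_lift_delta i _ (fun d => D V (even_coord m i d) x)) //.
  rewrite mulr_suml -sumrB mulr_suml; apply: eq_bigr => a _.
  rewrite block_mxEul !mxE (rmorphM (gconst m) (x 0 i / x 0 j)) rmorphB /=.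
  rewrite (rmorphM (gconst m) (lift i a == j)%:R) !rmorph_nat /=.
  by rewrite [X in _ = _ * X]gconstMC mulrA mulrBr !mulrA.
rewrite coord_rshift (tangent_odd_coord pV Vi Vj) //.
rewrite mulrBl [LHS]addrC; congr (_ + _).
  rewrite -(@sum_lift_delta i j (fun d => D V (even_coord m i d) x)) //.
  rewrite !mulr_suml -sumrN; apply: eq_bigr => a _.
  by rewrite block_mxEur mxE mulrN !mulrA.
rewrite (bigD1 k) //= big1 ?addr0 => [|a /negPf ak].
  by rewrite block_mxEdr !mxE eqxx.
by rewrite block_mxEdr !mxE ak mulr0n rmorph0 mulr0.
Qed.

Lemma struct_sheaf_gconst V (h : point -> K) : open V -> holomorphic V h ->
  (forall l x, l != 0 -> V x -> h (l *: x) = h x) ->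
  struct_sheaf V (fun x => gconst m (h x)).
Proof.
move=> Vo hh hs.
rewrite (_ : (fun x => _) = fun x : point => gconst m (h x) * 1); last first.
  by apply/funext => x; rewrite mulr1.
apply: (struct_sheaf_homog (d := 0)) => // [l x l0 Vx|A A0].
  by rewrite mul1r hs.
by rewrite gconstE -cards_eq0 (negPf A0).
Qed.

Lemma jacobian_struct i j a b :
  struct_sheaf (chart i `&` chart j) (fun x => jacobian i j x a b).
Proof.
have Oo : open (@chart K n i `&` chart j).
  by apply: proj_open_open; apply: proj_openI; exact: proj_open_chart.
have hV : holomorphic (chart i `&` chart j) (fun x : point => (x 0 j)^-1).
  by apply: holomorphic_coordV => // x [].
have hol_ratio c :
    holomorphic (chart i `&` chart j) (fun x : point => x 0 c / x 0 j).
  by apply: holomorphic_mul => //; exact: holomorphic_coord.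
have scale_ratio c l (x : point) :
    l != 0 -> (l *: x) 0 c / (l *: x) 0 j = x 0 c / x 0 j.
  by move=> l0; rewrite !mxE invfM mulrACA divff ?mul1r.
case: (split_ordP a) => k ->{a}; case: (split_ordP b) => k' ->{b}.
- rewrite (_ : (fun x => _) = fun x : point => gconst m (x 0 i / x 0 j *
      ((lift i k == lift j k')%:R +
       - (lift i k == j)%:R * (x 0 (lift j k') / x 0 j)))).
    apply: struct_sheaf_gconst => // [|l x l0 _]; last by rewrite !scale_ratio.
    apply: holomorphic_mul => //; apply: holomorphic_add => //.
      exact: holomorphic_cst.
    by apply: holomorphic_mul => //; exact: holomorphic_cst.
  by apply/funext => x; rewrite block_mxEul !mxE mulNr.
- rewrite (_ : (fun x => _) = fun x : point => gconst m (- (lift i k == j)%:R *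
      ((x 0 j)^-1 * (x 0 i / x 0 j))) * ggen K k').
    apply: (struct_sheaf_homog (d := 1)) => // [|l x l0 _|A A1].
    - by do 2?[apply: holomorphic_mul => //]; exact: holomorphic_cst.
    - by rewrite scale_ratio // mxE invfM expr1 -!mulrA mulrCA mulVKf.
    - by rewrite ggenE; case: eqP => // A0; rewrite A0 cards1 in A1.
  apply/funext => x; rewrite block_mxEur mxE /odd_coord /even_coord.
  rewrite -(rmorph_nat (gconst m)) -gconstMC !mulrA -!rmorphM.
  rewrite -mulNr -rmorphN /=.
  by congr (gconst m _ * _); ring.
- rewrite (_ : (fun x => _) = fun x : point => gconst m 0).
    apply: struct_sheaf_gconst => //; exact: holomorphic_cst.
  by apply/funext => x; rewrite block_mxEdl mxE rmorph0.
rewrite (_ : (fun x => _) = fun x : point =>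
    gconst m (x 0 i / x 0 j * (k == k')%:R)).
  apply: struct_sheaf_gconst => // [|l x l0 _]; last by rewrite scale_ratio.
  by apply: holomorphic_mul => //; exact: holomorphic_cst.
by apply/funext => x; rewrite block_mxEdr !mxE mulr_natr.
Qed.

Lemma gpartial_gconstM_var c (h : point -> K) (a : grassmann K m) x :
  derivable h x (delta_mx 0 c) ->
  gpartial c (fun y => gconst m (h y) * a) x =
  gconst m ('D_(delta_mx 0 c) h x) * a.
Proof.
move=> dh; apply: grassmannP => A; rewrite gpartialE gcoef_gconstM.
rewrite (_ : (fun _ => _) = a A *: h); first by rewrite deriveZ // mulrC.
by apply/funext => y; rewrite gcoef_gconstM mulrC.
Qed.

(** The fields that detect the coefficients of a form in the coordinate frame;
    they yield the uniqueness of transition matrices. *)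
Lemma dual_derivation i U (a : 'I_(n + m)) : U `<=` chart i ->
  exists2 D : family K n m, tangent U D &
    forall a' x, U x -> D U (coord i a') x = (a' == a)%:R.
Proof.
move=> Ui; case: (split_ordP a) => k ->{a}.
  exists (@even_der K n m i (lift i k)); first exact: tangent_even_der.
  move=> a' x /Ui xi.
  have v0 : (delta_mx 0 (lift i k) : point) 0 i = 0.
    by rewrite mxE (negPf (neq_lift _ _)).
  have dc c : derivable (fun y : point => y 0 c) x (delta_mx 0 (lift i k)).
    by apply: diff_derivable; exact: differentiable_coord.
  have dV : derivable (fun y : point => (y 0 i)^-1) x (delta_mx 0 (lift i k)).
    exact: derivableV.
  have DV : 'D_(delta_mx 0 (lift i k)) (fun y : point => (y 0 i)^-1) x = 0.
    by rewrite deriveV // derive_coord v0 scaler0.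
  rewrite /even_der; case: (split_ordP a') => k' ->{a'}.
    rewrite coord_lshift (_ : even_coord m i _ =
      fun y => gconst m (y 0 (lift i k') / y 0 i) * 1); last first.
      by apply/funext => y; rewrite mulr1.
    rewrite gpartial_gconstM_var; last exact: derivableM.
    rewrite (deriveM (dc _) dV) DV derive_coord scaler0 add0r mxE eqxx /=.
    rewrite mulr1 -rmorphM.
    rewrite (inj_eq (@lift_inj _ _)) (inj_eq (@lshift_inj _ _)) /=.
    by rewrite -(rmorph_nat (gconst m)) /GRing.scale /= mulrA divff // mul1r.
  rewrite coord_rshift gpartial_gconstM_var // DV rmorph0 mul0r mulr0.
  by rewrite eq_rlshift.
exists (odd_der i k); first exact: tangent_odd_der.
move=> a' x /Ui xi; rewrite /odd_der; case: (split_ordP a') => k' ->{a'}.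
  by rewrite coord_lshift gderiv_gconst mulr0 eq_lrshift.
rewrite coord_rshift gderiv_gconstM gderiv_ggen mulrA.
rewrite -rmorphM mulfV // rmorph1 mul1r.
by rewrite (inj_eq (@rshift_inj _ _)) eq_sym.
Qed.

(** A transition matrix is recovered entry by entry, by evaluating the relation
    between the frames on the dual fields. *)
Lemma transition_unique i j (T T' : point -> 'M[grassmann K m]_(n + m)) :
  frame_change i j T -> frame_change i j T' ->
  forall x, (chart i `&` chart j) x -> T x = T' x.
Proof.
have pO : proj_open (@chart K n i `&` chart j).
  by apply: proj_openI; exact: proj_open_chart.
move=> hT hT' x Ox; apply/matrixP => a b.
have Oi : @chart K n i `&` chart j `<=` chart i by move=> ? [].
have [D tD Da] := dual_derivation a Oi.
have entry (S : point -> 'M[grassmann K m]_(n + m)) :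
    (\sum_a' sh_scale (@cotangent_frame K n m i a') (fun x => S x a' b))
      (chart i `&` chart j) D x = S x a b.
  rewrite cotangent_sumE (bigD1 a) //= big1 ?addr0 => [|a' /negPf aa'].
    rewrite -[LHS]/(D (chart i `&` chart j) (coord i a) x * S x a b).
    by rewrite Da // eqxx mul1r.
  rewrite -[LHS]/(D (chart i `&` chart j) (coord i a') x * S x a' b).
  by rewrite Da // aa' mul0r.
rewrite -(entry T) -(entry T').
rewrite -(hT b _ _ pO (@subset_refl _ _) tD x Ox).
exact: hT' b _ _ pO (@subset_refl _ _) tD x Ox.
Qed.

Lemma transition_cotangent i j (x : point) : (chart i `&` chart j) x ->
  transition (@cotangent_frame K n m) i j x = jacobian i j x.
Proof.
move=> Ox; rewrite /transition.
apply: (transition_unique _ (@jacobian_transition i j)) => //.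
case: xgetP => [T _ []//|/(_ (jacobian i j)) []].
by split=> [a b|]; [exact: jacobian_struct | exact: jacobian_transition].
Qed.

Lemma ring_inv_unique (A : pzRingType) (u v : A) :
  u * v = 1 -> v * u = 1 -> ring_inv u = v.
Proof.
move=> uv vu; rewrite /ring_inv; case: xgetP => [w _ [uw wu]|/(_ v) []//].
by rewrite -[w]mul1r -vu -mulrA uw mulr1.
Qed.

(** With u = x_j / x_i, the odd block contributes u^m, the scalar factor of the
    even block u^-n, and its minor (-1)^(i + j) u^-1. *)
Lemma berezinian_jacobian i j (x : point) : x 0 i != 0 -> x 0 j != 0 ->
  berezinian (jacobian i j x) =
    gconst m ((-1) ^+ (i + j) * (x 0 j / x 0 i) ^ (m%:Z - n%:Z - 1)).
Proof.
move=> xi xj.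
rewrite /berezinian block_mxKul block_mxKdl block_mxKdr mulmx0 subr0.
rewrite !det_map_mx det_scalar /even_jacobian detZ.
rewrite (@det_minor_1Drank2 _ _ i j (fun c => x 0 c / x 0 j)) ?divff //.
rewrite (@ring_inv_unique _ _ (gconst m ((x 0 i / x 0 j) ^- m))); first last.
- by rewrite -rmorphM mulVf ?rmorph1 // expf_neq0 // mulf_neq0 ?invr_eq0.
- by rewrite -rmorphM mulfV ?rmorph1 // expf_neq0 // mulf_neq0 ?invr_eq0.
rewrite -rmorphM /=; congr gconst; rewrite mulrCA -mulrA; congr (_ * _).
have u0 : x 0 i / x 0 j != 0 by rewrite mulf_neq0 ?invr_eq0.
rewrite -(invf_div (x 0 i)) exprz_inv !opprB.
rewrite -exprSr exprnP exprnN -expfzDr //; congr (_ ^ _).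
by rewrite -addn1 PoszD addrCA addrA addrAC.
Qed.

End Jacobian.

(** * The isomorphism *)

(** Transition functions that differ by the coboundary of the constants c i
    define isomorphic bundles: multiply the section on chart i by c i. *)
Lemma line_bundle_iso (K : numFieldType) (n m : nat) (c : 'I_n.+1 -> K)
    (g h : 'I_n.+1 -> 'I_n.+1 -> 'rV[K]_n.+1 -> grassmann K m) :
  (forall i, c i != 0) ->
  (forall i j (x : 'rV[K]_n.+1), x 0 i != 0 -> x 0 j != 0 ->
    gconst m (c i) * g i j x = h i j x * gconst m (c j)) ->
  isomorphic (line_bundle g) (line_bundle h).
Proof.
move=> c0 gh; exists (fun U s i x => gconst m (c i) * s i x).
have sheaf_scale (k : 'I_n.+1 -> K) U i s : proj_open U ->
    struct_sheaf (U `&` chart i) s ->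
    struct_sheaf (U `&` chart i) (fun x => gconst m (k i) * s x).
  move=> pU; apply: struct_sheaf_gconstM; apply: proj_open_open.
  by apply: proj_openI => //; exact: proj_open_chart.
have cV i : gconst m (c i)^-1 * gconst m (c i) = 1.
  by rewrite -rmorphM mulVf ?rmorph1.
have cK i : gconst m (c i) * gconst m (c i)^-1 = 1.
  by rewrite -rmorphM mulfV ?rmorph1.
split.
- move=> U s pU [ss gs]; split=> [i|i j x Ox]; first exact: sheaf_scale.
  have [[_ xi] xj] := Ox.
  by rewrite (gs i j x Ox) mulrA gh // -mulrA.
- by move=> U V s t _ _ _ _ _ st i x Vx; rewrite st.
- by move=> U s t _ _ _ i x _; rewrite mulrDr.
- by move=> U s f _ _ _ i x _; rewrite /= mulrA.
- move=> p U s _ _ ps i x A Ux pA; rewrite gcoef_gconstM.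
  by rewrite ps // mulr0.
- move=> U s t _ _ _ st i x Ux.
  have /(congr1 ( *%R (gconst m (c i)^-1))) := st i x Ux.
  by rewrite !mulrA cV !mul1r.
move=> U t pU [st ht]; exists (fun i x => gconst m (c i)^-1 * t i x).
  split=> [i|i j x Ox]; first exact: (sheaf_scale (fun i => (c i)^-1)).
  have [[_ xi] xj] := Ox; rewrite (ht i j x Ox).
  have -> : (g i j * (fun x => gconst m (c j)^-1 * t j x)) x =
      gconst m (c i)^-1 * (gconst m (c i) * g i j x) *
      (gconst m (c j)^-1 * t j x).
    by rewrite !mulrA cV mul1r.
  by rewrite gh // -!mulrA; congr (_ * (_ * _)); rewrite mulrA cK mul1r.
by move=> i x _; rewrite mulrA cK mul1r.
Qed.

Theorem theorem5 (R : realType) (n m : nat) :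
  isomorphic (Ber (@cotangent_frame R[i] n m))
             (twisting_sheaf R[i] n m (m%:Z - n%:Z - 1)).
Proof.
(* The determinant of the even block carries the sign (-1)^(i + j). *)
apply: (line_bundle_iso (c := fun i => (-1) ^+ i)) => [i|i j x xi xj].
  by rewrite signr_eq0.
rewrite transition_cotangent // berezinian_jacobian // -!rmorphM /=.
by rewrite exprD !mulrA -expr2 sqrr_sign mul1r mulrC.
Qed.
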